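(* Let $n\ge2$, let $r\in[n]$, and let $\Gamma=([n],A(\Gamma))$ be a digraph with $A(\Gamma)\subseteq[n]\times([n]\setminus\{r\})$ (loops allowed). Let $$\mathcal J_r(\Gamma)=\mathcal C_n^n\setminus\{x_r-x_j=a\mid (a,j)\in A(\Gamma)\},$$ an arrangement in $\mathbb R^n$. Then $$\chi(\mathcal J_r(\Gamma),t)=t(t-n^2-1)^{\underline{n-1}}+t\sum_{a=1}^{n}\deg^+_{\Gamma}(a)\,(t-n^2+n-a-1)^{\underline{n-2}}.$$
   Context: Notation: $[n]=\{1,\dots,n\}$. Falling factorial: $x^{\underline r}=x(x-1)\cdots(x-r+1)$, $x^{\underline 0}=1$. $\mathcal C_n^n$ is the full $n$-Catalan arrangement in $\mathbb R^n$: $$\mathcal C_n^n=\{x_i-x_j=0\mid 1\le i<j\le n\}\cup\{x_i-x_j=s\mid 1\le i\ne j\le n,\ 1\le s\le n\}.$$ For a finite hyperplane arrangement $\mathcal A$ in $\mathbb R^n$, $L(\mathcal A)$ is the poset of nonempty intersections of subfamilies of $\mathcal A$, ordered by reverse inclusion, with minimum $\hat 0=\mathbb R^n$ (the empty intersection). With $\mu$ the Möbius function of $L(\mathcal A)$, the characteristic polynomial is $\chi(\mathcal A,t)=\sum_{X\in L(\mathcal A)}\mu(\hat 0,X)t^{\dim X}$. The arc set is a set of ordered pairs; loops $(a,a)$ with $a\neq r$ are allowed, and no arc has head $r$. For $a\in[n]$, $\deg^+_\Gamma(a)=\#\{j\in[n]\setminus\{r\}:(a,j)\in A(\Gamma)\}$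 is the outdegree. *)

(* Defs.v *)
From HB Require Import structures.
From mathcomp Require Import all_boot all_order all_algebra finmap.
From mathcomp Require Import boolp classical_sets functions cardinality reals.

Set Implicit Arguments.
Unset Strict Implicit.
Unset Printing Implicit Defensive.

Import Order.TTheory GRing.Theory Num.Theory.
Local Open Scope classical_set_scope.
Local Open Scope ring_scope.

(* The first argument bounds the recursion depth. *)
Fixpoint moebius_rec {d : Order.disp_t} {T : porderType d} (S : {fset T})
    (k : nat) (x y : T) : int :=
  if k is k'.+1 then
    if x == y then 1
    else if (x < y)%O then
      - \sum_(z <- S | (x <= z < y)%O) moebius_rec S k' x z
    else 0
  else 0.

(* The Moebius function of the finite poset S; the depth #|` S| is always
   sufficient, so that the usual recursion holds: see [moebiusE]. *)
Definition moebius {d : Order.disp_t} {T : porderType d} (S : {fset T})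
    (x y : T) : int := moebius_rec S #|` S| x y.

Lemma count_le_lt {d : Order.disp_t} {T : porderType d} (S : {fset T})
    (z y : T) : y \in S -> (z < y)%O ->
  (count (fun w => (w <= z)%O) S < count (fun w => (w <= y)%O) S)%N.
Proof.
move=> yS zy; have : y \in (S : seq T) by [].
elim: (S : seq T) => //= a s IH; rewrite inE => /orP[/eqP <-|ys].
  rewrite lexx (lt_geF zy) add0n add1n ltnS.
  by apply: sub_count => w /le_trans; apply; exact: ltW.
rewrite -addnS leq_add //; last exact: IH.
by case: (boolP (a <= z)%O) => // /le_trans /(_ (ltW zy)) ->.
Qed.

Lemma moebius_rec_depth {d : Order.disp_t} {T : porderType d} (S : {fset T})
    (x y : T) (k l : nat) : y \in S ->
  (count (fun w => (w <= y)%O) S <= k)%N ->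
  (count (fun w => (w <= y)%O) S <= l)%N ->
  moebius_rec S k x y = moebius_rec S l x y.
Proof.
elim: k l y => [|k IH] l y yS.
  rewrite leqn0 => /eqP /eqP; rewrite -leqn0 leqNgt -has_count => /hasPn /(_ y yS).
  by rewrite lexx.
case: l => [|l] hk hl.
  move: hl; rewrite leqn0 => /eqP /eqP; rewrite -leqn0 leqNgt -has_count.
  by move=> /hasPn /(_ y yS); rewrite lexx.
rewrite /=; case: eqP => // _; case: ifP => // _; congr (- _).
rewrite big_seq_cond [RHS]big_seq_cond; apply: eq_bigr => z /and3P[zS _ zy].
by apply: IH => //; rewrite -ltnS; apply: leq_trans (count_le_lt yS zy) _.
Qed.

Lemma moebiusE {d : Order.disp_t} {T : porderType d} (S : {fset T})
    (x y : T) : y \in S ->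
  moebius S x y = if x == y then 1 else if (x < y)%O then
    - \sum_(z <- S | (x <= z < y)%O) moebius S x z else 0.
Proof.
move=> yS; rewrite {1}/moebius.
have hS : (count (fun w => (w <= y)%O) S <= #|` S|)%N by apply: count_size.
rewrite (moebius_rec_depth x yS hS (leqW hS)) /=.
by [].
Qed.

Section Arrangements.
Context {R : realType} {n : nat}.
Local Notation V := 'rV[R]_n.

(* An arrangement is a set of subsets of R^n.  Its intersections lie in
   (set V)^d, where the order is reverse inclusion; the choice B = set0 gives
   the minimum setT. *)
Definition intersections (A : set (set V)) : set (set V)^d :=
  [set X | X !=set0 /\ exists2 B, B `<=` A & X = \bigcap_(H in B) H].

(* fset_set is the set itself as an {fset} when it is finite *)
Definition intersection_poset (A : set (set V)) : {fset (set V)^d} :=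
  fset_set (intersections A).

Lemma finite_intersections (A : set (set V)) :
  finite_set A -> finite_set (intersections A).
Proof.
move=> /finite_fsetP[F ->].
apply: (@sub_finite_set _ _
  ((fun B : {fset set V} => \bigcap_(H in [set` B]) H) @` [set` fpowerset F])).
  move=> X [_ [B BF ->]]; exists (fset_set B) => /=.
    rewrite fpowersetE; apply/fsubsetP => H.
    by rewrite in_fset_set ?inE; [exact: BF|exact: sub_finite_set BF _].
  by rewrite fset_setK //; exact: sub_finite_set BF _.
exact: finite_image.
Qed.

(* The translation space of an affine subspace, 0 on other sets. *)
Definition direction (X : set V) : {vspace V} :=
  xget 0%VS [set U | exists p, X = [set p + u | u in [set` U]]].

Definition affine_dim (X : set V) : nat := \dim (direction X).

(* The variable t is 'X. *)
Definition characteristic_polynomial (A : set (set V)) : {poly int} :=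
  \sum_(X <- intersection_poset A)
    moebius (intersection_poset A) (setT : (set V)^d) X *: 'X^(affine_dim X).

Definition diff_hyperplane (i j : 'I_n) (s : nat) : set V :=
  [set x | x ord0 i - x ord0 j = s%:R].

End Arrangements.

Definition catalan_arrangement (R : realType) (n m : nat) : set (set 'rV[R]_n) :=
  [set H | exists i j : 'I_n, (i < j)%N /\ H = diff_hyperplane i j 0] `|`
  [set H | exists (i j : 'I_n) (s : nat),
     [/\ i != j, (1 <= s <= m)%N & H = diff_hyperplane i j s]].

Arguments catalan_arrangement : clear implicits.

(* Vertices are 'I_n = {0, ..., n - 1}: the element i : 'I_n stands for the
   label i.+1 in {1, ..., n}. *)
Definition catalan_deletion (R : realType) (n : nat) (r : 'I_n)
    (G : {set 'I_n * 'I_n}) : set (set 'rV[R]_n) :=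
  catalan_arrangement R n n `\`
  [set H | exists a j : 'I_n, (a, j) \in G /\ H = diff_hyperplane r j a.+1].

Arguments catalan_deletion R {n} r G.

Lemma finite_catalan_deletion (R : realType) (n : nat) (r : 'I_n)
    (G : {set 'I_n * 'I_n}) : finite_set (catalan_deletion R r G).
Proof.
apply: (@sub_finite_set _ _
  ((fun p : 'I_n * 'I_n * 'I_n.+1 => diff_hyperplane p.1.1 p.1.2 p.2) @` setT)).
  move=> H [[[i [j [_ ->]]]|[i [j [s [_ /andP[_ sn] ->]]]]] _].
    by exists (i, j, ord0).
  by exists (i, j, inord s) => //=; rewrite inordK.
exact/finite_image/finite_finset.
Qed.

Definition outdegree (n : nat) (r : 'I_n) (G : {set 'I_n * 'I_n}) (a : 'I_n) :=
  #|[pred j : 'I_n | (j != r) && ((a, j) \in G)]|.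

Definition falling_power (A : comNzRingType) (x : A) (k : nat) : A :=
  \prod_(i < k) (x - i%:R).

(* Main.v *)
From HB Require Import structures.
Require Import Defs.
From mathcomp Require Import all_boot all_order all_algebra finmap.
From mathcomp Require Import boolp classical_sets cardinality reals.
From mathcomp Require Import zify lra.

Set Implicit Arguments.
Unset Strict Implicit.
Unset Printing Implicit Defensive.

Import Order.TTheory GRing.Theory Num.Theory.
Local Open Scope ring_scope.

(** The proof is by the finite field method, carried out over the ring Z/q for
    every large integer q instead of a prime field.  All the hyperplanes have
    equations x_i - x_j = s with a small integer s, so an arrangement of this
    kind can be read modulo q.  Two facts make the reading faithful.  A
    nonempty real intersection X contains an integer point and is a translate
    of the space of vectors that are constant on the classes of an equivalence
    relation on the coordinates; hence X has q ^ dim X points modulo q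
    ([card_points_on_flat]).  Conversely, n points on a circle of length q leave
    an arc of length m free as soon as n m < q; cutting the circle there turns
    all the relations p_i - p_j = s <= m that hold modulo q into relations
    between integers ([exists_integer_lift]), so that the hyperplanes through a
    point modulo q have a common real point.  Writing q ^ dim X as a sum over
    the points of X and exchanging the sums, Moebius inversion leaves exactly
    the points on no hyperplane: the characteristic polynomial takes at q the
    value #{p in (Z/q)^n | p is on no hyperplane} ([finite_field_method]).

    It remains to count, for the deleted Catalan arrangement, the placements p
    of n labelled points on the circle Z/q.  Rotating, let p_r = 0.  Any two
    points are more than n apart, except that p_j may be at a distance a <= n
    behind p_r when (a, j) is an arc.  At most one j can be that close, because
    two of them would be less than n apart from each other.
    If none is, the other n - 1 points lie in a window of the line;
    otherwise p_j is determined by the arc and the other n - 2 points lie in a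
    shorter window ([card_avoids_at_origin]).  In a window of length L, the
    placements of k points with gaps larger than d become the injections into a
    window of length L - (k - 1) d once d places are deleted after each point;
    they are counted by a falling factorial ([card_separated]).  This gives the
    values of both sides at all large q, and two polynomials that agree there
    are equal. *)

(** * The finite field method over Z/q *)

Lemma moebius_sum {d : Order.disp_t} {T : porderType d} (S : {fset T}) (x y : T) :
  y \in S -> (x <= y)%O ->
  \sum_(z <- S | (x <= z <= y)%O) moebius S x z = (x == y)%:R.
Proof.
move=> yS xy; rewrite big_mkcond (bigD1_seq y) ?fset_uniq //= xy lexx /= moebiusE //.
case: eqVneq => [<-|nxy].
  rewrite -big_mkcondr big1 ?addr0 // => z /and3P[zx xz zx']; move: zx.
  by rewrite eq_le xz zx'.
rewrite lt_neqAle nxy xy /= addrC; apply/eqP; rewrite subr_eq0; apply/eqP.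
rewrite -big_mkcondr; apply: eq_bigl => z /=.
by rewrite lt_neqAle; case: (z == y); rewrite ?andbF.
Qed.

(** Numbering the classes by 'I_k lets the dimension count and the count modulo q
    refer to the same k; d chooses a representative of each class. *)
Lemma exists_class_map (n : nat) (e : rel 'I_n) : equivalence_rel e ->
  exists (k : nat) (c : 'I_n -> 'I_k) (d : 'I_k -> 'I_n),
    cancel d c /\ forall i j, e i j = (c i == c j).
Proof.
move=> eqe.
have er i : e i i by case: (eqe i i i).
pose rep i := odflt i [pick j | e i j].
have erep i : e i (rep i).
  by rewrite /rep; case: pickP => [//|/(_ i)]; rewrite er.
have repE i j : e i j -> rep i = rep j.
  move=> eij; rewrite /rep (@eq_pick _ (e i) (e j)) => [|k]; last first.
    by have [_ /(_ eij)] := eqe i j k.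
  by case: pickP => [//|/(_ j)]; rewrite er.
have eP i j : e i j = (rep i == rep j).
  apply/idP/eqP => [/repE//|h].
  have [_ /(_ (erep i)) ->] := eqe i (rep i) j.
  have [_ /(_ (erep j))] := eqe j (rep j) j.
  by rewrite h er => <-.
have repK i : rep (rep i) == rep i.
  by rewrite -eP; have [_ /(_ (erep i)) <-] := eqe i (rep i) i.
pose T := {k : 'I_n | rep k == k}.
exists #|{: T}|, (fun i => enum_rank (exist _ (rep i) (repK i) : T)),
  (fun k => val (enum_val k)).
split=> [k|i j].
  apply: (can_inj enum_valK); rewrite enum_rankK; apply: val_inj => /=.
  exact/eqP/(valP (enum_val k)).
by rewrite (can_eq enum_rankK) -val_eqE /= eP.
Qed.

Lemma val_addn_residue q (a : 'I_q.+2) (s : nat) :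
  val (a + s%:R) = ((a + s) %% q.+2)%N.
Proof. by rewrite /= Zp_nat /= modnDmr. Qed.

(** Each p i forbids m positions of the cut c, namely those for which p i would
    lie in the last m places before the cut.  A cut that avoids these n m
    positions leaves the residues p i - c in [0, q - m[, where adding s <= m
    does not wrap around. *)
Lemma exists_integer_lift (n m q : nat) (p : 'I_n -> 'I_q.+2) : (n * m < q.+2)%N ->
  exists (x : 'I_n -> nat) (c : 'I_q.+2), (forall i, (x i)%:R = p i - c) /\
    forall i j s, (s <= m)%N -> p i - p j = s%:R -> x i = (x j + s)%N.
Proof.
move=> hq; pose B := [set p ik.1 + (ik.2 : nat).+1%:R | ik : 'I_n * 'I_m].
have [c cB] : exists c, c \notin B.
  suff /subsetPn[c _ cB] : ~~ ([set: 'I_q.+2] \subset B) by exists c.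
  apply/negP => /subset_leq_card; rewrite cardsT card_ord leqNgt => /negP; apply.
  by apply: leq_ltn_trans (leq_imset_card _ _) _; rewrite card_prod !card_ord.
have xlt i : (val (p i - c)%R < q.+2 - m)%N.
  rewrite ltnNge; apply/negP => hi; have hlt := ltn_ord (p i - c).
  have hk : (q.+1 - val (p i - c)%R < m)%N.
    by move: hi hlt => /=; move: (nat_of_ord _) => v; lia.
  move/imsetP: cB; apply; exists (i, Ordinal hk) => //=; apply/esym/eqP.
  rewrite -subr_eq0 addrAC; apply/eqP/val_inj; rewrite val_addn_residue.
  rewrite (_ : (_ + _)%N = q.+2) ?modnn //=.
  by move: hi hlt => /=; move: (nat_of_ord _) => v; lia.
exists (fun i => val (p i - c)), c; split=> [i|i j s sm pij]; first exact: natr_Zp.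
have -> : p i - c = (p j - c) + s%:R by rewrite -pij [RHS]addrC addrA subrK.
rewrite val_addn_residue modn_small //; have := xlt j => /=.
by move: (nat_of_ord _) => v; lia.
Qed.

Lemma card_class_functions (n k : nat) (A : finType)
    (c : 'I_n -> 'I_k) (d : 'I_k -> 'I_n) :
  cancel d c ->
  #|[set f : {ffun 'I_n -> A} | [forall i, forall j, (c i == c j) ==> (f i == f j)]]|
    = (#|A| ^ k)%N.
Proof.
move=> dK; rewrite -{2}(card_ord k) -card_ffun -cardsT.
pose F (g : {ffun 'I_k -> A}) := [ffun i => g (c i)] : {ffun 'I_n -> A}.
rewrite -(@card_imset _ _ F) => [|g g' /ffunP gg']; last first.
  by apply/ffunP => l; have := gg' (d l); rewrite !ffunE dK.
congr #|pred_of_set _|; apply/setP => f; rewrite inE; apply/idP/imsetP => [hf|[g _ ->]].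
  exists [ffun l => f (d l)] => //; apply/ffunP => i; rewrite !ffunE.
  by move/forallP/(_ i)/forallP/(_ (d (c i))): hf; rewrite dK eqxx => /eqP.
by apply/forallP => i; apply/forallP => j; rewrite !ffunE; apply/implyP => /eqP ->.
Qed.

Section Flats.
Local Open Scope classical_set_scope.
Context {R : realType} {n m : nat}.
Implicit Types (e : 'I_n * 'I_n * 'I_m.+1) (E : {set 'I_n * 'I_n * 'I_m.+1}).
Local Notation V := 'rV[R]_n.

(** The triple (i, j, s) encodes the equation x_i - x_j = s, which makes sense
    both over the reals and modulo q. *)
Definition gain_hyperplane e : set V := diff_hyperplane e.1.1 e.1.2 e.2.

Definition gain_arrangement E : set (set V) := [set gain_hyperplane e | e in [set` E]].

Definition lies_on {q} (p : 'I_n -> 'I_q.+2) e := p e.1.1 - p e.1.2 == (e.2 : nat)%:R.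

(** The smallest real flat whose reduction modulo q contains p: a flat X
    contains p modulo q exactly when it contains [flat_through E p]. *)
Definition flat_through {q} E (p : 'I_n -> 'I_q.+2) : set V :=
  \bigcap_(e in [set e | e \in E /\ lies_on p e]) gain_hyperplane e.

Lemma finite_gain_arrangement E : finite_set (gain_arrangement E).
Proof. exact/finite_image/finite_finset. Qed.

Lemma integer_lift_in_flat q E (p : 'I_n -> 'I_q.+2) : (n * m < q.+2)%N ->
  exists (x : 'I_n -> nat) (c : 'I_q.+2), (forall i, (x i)%:R = p i - c) /\
    flat_through E p (\row_i (x i)%:R).
Proof.
move=> /(@exists_integer_lift n m q p)[x [c [xc xp]]]; exists x, c; split=> //.
move=> e [eE /eqP/xp]; rewrite -ltnS ltn_ord => /(_ isT) xe.
by rewrite /gain_hyperplane /diff_hyperplane /= !mxE xe natrD addrC addKr.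
Qed.

Lemma flat_through_intersection q E (p : 'I_n -> 'I_q.+2) : (n * m < q.+2)%N ->
  intersections (gain_arrangement E) (flat_through E p).
Proof.
move=> hq; split.
  by have [x [c [_ ?]]] := integer_lift_in_flat E p hq; exists (\row_i (x i)%:R).
exists [set gain_hyperplane e | e in [set e | e \in E /\ lies_on p e]].
  by move=> _ [e [eE _] <-]; exists e.
by rewrite bigcap_image.
Qed.

Lemma direction_translate (X : set V) (U : {vspace V}) (v : V) :
  X = [set v + u | u in [set` U]] -> direction X = U.
Proof.
move=> XU; have : exists p, X = [set p + u | u in [set` direction X]].
  apply: (@xgetPex _ 0%VS [set W | exists p, X = [set p + u | u in [set` W]]]).
  by exists U, v.
move: (direction X) => W [v' XU'].
have aux (A B : {vspace V}) a b : X = [set a + u | u in [set` A]] ->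
    X = [set b + u | u in [set` B]] -> (A <= B)%VS.
  move=> XA XB; apply/subvP => u uA.
  have : X (a + u) by rewrite XA; exists u.
  have : X (a + 0) by rewrite XA; exists 0 => //=; rewrite mem0v.
  rewrite XB => -[w1 /= w1B h1] [w2 /= w2B h2].
  have -> : u = w2 - w1.
    by apply: (addrI a); rewrite -h2 addrA -(addr0 a) -h1; rewrite addrAC addrK.
  exact: rpredB.
by apply: subv_anti; rewrite (aux _ _ _ _ XU XU') (aux _ _ _ _ XU' XU).
Qed.

(** Together with [card_class_functions], this is why the dimension over the reals
    is the exponent of q in the count modulo q. *)
Lemma class_vectors_vspace (k : nat) (c : 'I_n -> 'I_k) (d : 'I_k -> 'I_n) :
  cancel d c -> exists U : {vspace V}, \dim U = k /\
    forall u : V, u \in U <-> forall i j, c i = c j -> u ord0 i = u ord0 j.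
Proof.
move=> dK; pose g (y : 'rV[R]_k) : V := \row_i y ord0 (c i).
have glin : linear g by move=> a y z; apply/rowP => i; rewrite !mxE.
pose gL := GRing.isLinear.Build _ _ _ _ g glin.
pose G : {linear 'rV[R]_k -> V} := HB.pack g gL.
exists (limg (linfun G)); split.
  rewrite limg_dim_eq; first by rewrite dimvf /dim /= mul1n.
  apply/eqP; rewrite -subv0; apply/subvP => y; rewrite memv_cap memvf memv_ker lfunE /=.
  move=> /eqP/rowP gy; rewrite memv0; apply/eqP/rowP => l.
  by have := gy (d l); rewrite !mxE dK.
move=> u; split=> [/memv_imgP[y _ ->] i j cij|hu]; first by rewrite lfunE /= !mxE cij.
apply/memv_imgP; exists (\row_l u ord0 (d l)); rewrite ?memvf // lfunE /=.
by apply/rowP => i; rewrite !mxE; apply: hu; rewrite dK.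
Qed.
End Flats.

Section FiniteField.
Local Open Scope classical_set_scope.
Context {R : realType} {n m : nat}.
Implicit Types (e : 'I_n * 'I_n * 'I_m.+1) (E : {set 'I_n * 'I_n * 'I_m.+1}).
Local Notation V := 'rV[R]_n.

(** Over the reals and modulo q, X is the translate by the same integer point of
    the functions constant on the classes of one equivalence relation.  This
    relation is read off X itself (i and j are related when x_i - x_j is constant
    on X), which dispenses with paths along the hyperplanes that define X. *)
Lemma card_points_on_flat q E (X : set V) : (n * m < q.+2)%N ->
  intersections (gain_arrangement E) X ->
  #|[set p : {ffun 'I_n -> 'I_q.+2} | `[< flat_through E p `<=` X >] ]%SET|
    = (q.+2 ^ affine_dim X)%N.
Proof.
move=> hq [[x0 Xx0] [B BA XE]].
(* Rounding down preserves the equations, since their right-hand sides are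
   integers. *)
pose v i : int := Num.floor (x0 ord0 i).
pose xv : V := \row_i (v i)%:~R.
have Bv e : B (gain_hyperplane e) -> v e.1.1 = v e.1.2 + (e.2 : nat).
  move=> He; have : gain_hyperplane e x0 by move: Xx0; rewrite XE; apply.
  rewrite /gain_hyperplane /diff_hyperplane /= => /(congr1 (fun y => y + x0 ord0 e.1.2)).
  rewrite subrK /v => ->; rewrite addrC floorDrz ?natr_int //.
  by congr (_ + _); apply: (@intr_inj R); rewrite floorK ?natr_int.
have Xxv : X xv.
  rewrite XE => H BH; have [e _ He] := BA _ BH.
  rewrite -He /gain_hyperplane /diff_hyperplane /= !mxE Bv ?He //.
  by rewrite intrD addrC addKr.
pose par i j := `[< forall x y : V, X x -> X y ->
   x ord0 i - x ord0 j = y ord0 i - y ord0 j >].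
have eqpar : equivalence_rel par.
  apply/equivalence_relP; split=> [i|i j /asboolP ij k].
    by apply/asboolP => x y _ _; rewrite !subrr.
  apply/asboolP/asboolP => h x y Xx Xy; have := h x y Xx Xy; have := ij x y Xx Xy; lra.
have Bpar e : B (gain_hyperplane e) -> par e.1.1 e.1.2.
  move=> He; apply/asboolP => x y; rewrite XE => /(_ _ He) hx /(_ _ He) hy.
  by rewrite hx hy.
have [k [c [d [dK parE]]]] := exists_class_map eqpar.
have [U [dimU UE]] := @class_vectors_vspace R n k c d dK.
have XU : X = [set xv + u | u in [set` U]].
  apply/seteqP; split=> [x Xx|_ [u /= /UE uU <-]].
    exists (x - xv); last by rewrite addrC subrK.
    apply/UE => i j /eqP; rewrite -parE => /asboolP /(_ x xv Xx Xxv) h.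
    by rewrite ![(x - xv) _ _]mxE ![(- xv) _ _]mxE; lra.
  rewrite XE => H BH; have [e _ He] := BA _ BH.
  have /Bpar : B (gain_hyperplane e) by rewrite He.
  rewrite parE -He /gain_hyperplane /diff_hyperplane => /eqP/uU /= ue.
  rewrite ![(xv + u) _ _]mxE ue opprD addrACA subrr addr0.
  have : gain_hyperplane e xv by rewrite He; move: Xxv; rewrite XE; apply.
  by [].
rewrite /affine_dim (direction_translate XU) dimU -[in RHS](card_ord q.+2).
rewrite -(card_class_functions _ dK).
pose F (f : {ffun 'I_n -> 'I_q.+2}) :=
  [ffun i => f i + (v i)%:~R] : {ffun 'I_n -> 'I_q.+2}.
have Finj : injective F.
  by move=> f g /ffunP fg; apply/ffunP => i; have := fg i; rewrite !ffunE => /addIr.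
rewrite -[in RHS](card_imset _ Finj).
congr #|pred_of_set _|; apply/setP => p; rewrite inE.
apply/asboolP/imsetP => [pX|[f + ->]].
  exists [ffun i => p i - (v i)%:~R]; last by apply/ffunP => i; rewrite !ffunE subrK.
  rewrite inE; apply/forallP => i; apply/forallP => j; apply/implyP.
  rewrite -parE => /asboolP ij; rewrite !ffunE.
  (* an integer lift of p lies on X, so its differences are those of v *)
  have [x [a [xa /pX Xx]]] := integer_lift_in_flat (R := R) E p hq.
  have := ij _ _ Xx Xxv; rewrite !mxE !pmulrn -!rmorphB /= => /intr_inj.
  move=> /(congr1 (fun z : int => z%:~R : 'I_q.+2)).
  rewrite !rmorphB /= -!pmulrn !xa opprB addrA subrK => h.
  by rewrite subr_eq addrAC -addrA -h addrC subrK.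
rewrite inE => /forallP hf; rewrite XE => x hx H BH; have [e eE He] := BA _ BH.
rewrite -He; apply: hx; split=> //; rewrite /lies_on !ffunE.
have Be : B (gain_hyperplane e) by rewrite He.
have := Bpar _ Be; rewrite parE => ce.
move: (hf e.1.1) => /forallP/(_ e.1.2); rewrite ce /= => /eqP ->.
by rewrite Bv // rmorphD /= opprD addrACA subrr add0r addrAC subrr add0r -pmulrn.
Qed.

(** Flats are ordered by reverse inclusion.  Since q ^ dim X counts the p with
    X <= flat_through E p, exchanging the sums gives each p the weight
    \sum_(X <= flat_through E p) mu(0, X), which is 1 if p lies on no hyperplane
    and 0 otherwise. *)
Lemma finite_field_method q E : (n * m < q.+2)%N ->
  (forall e, e \in E -> e.1.1 != e.1.2) ->
  (characteristic_polynomial (gain_arrangement E : set (set V))).[q.+2%:R] =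
    #|[set p : {ffun 'I_n -> 'I_q.+2} | [forall e in E, ~~ lies_on p e] ]%SET|%:R.
Proof.
move=> hq loopless; rewrite /characteristic_polynomial horner_sum.
set L := intersection_poset _.
have LP X : X \in L = `[< intersections (gain_arrangement E) X >].
  by rewrite /L in_fset_set //; exact/finite_intersections/finite_gain_arrangement.
have TL : (setT : (set V)^d) \in L.
  rewrite LP; apply/asboolP; split; first by exists 0.
  by exists set0 => //; rewrite bigcap_set0.
pose fl (p : {ffun 'I_n -> 'I_q.+2}) : (set V)^d := flat_through E p.
have flL p : fl p \in L by rewrite LP; apply/asboolP/flat_through_intersection.
have leT (X : (set V)^d) : ((setT : (set V)^d) <= X)%O by apply/subsetPset.
transitivity (\sum_(X <- L) \sum_p
    if (X <= fl p)%O then moebius L (setT : (set V)^d) X else 0).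
  rewrite big_seq_cond [RHS]big_seq_cond; apply: eq_bigr => X.
  rewrite andbT LP => /asboolP XL.
  rewrite hornerZ hornerXn -natrX -(card_points_on_flat hq XL) -big_mkcond sumr_const.
  rewrite mulr_natr; congr (_ *+ _); rewrite -cardsE; apply: eq_card => p; rewrite !inE.
  by apply/asboolP/subsetPset.
rewrite exchange_big /= -sum1_card natr_sum [RHS]big_mkcond /=; apply: eq_bigr => p _.
rewrite -big_mkcond.
under eq_bigl => X do rewrite -[(X <= _)%O]andTb -(leT X).
rewrite moebius_sum // inE.
suff -> : ((setT : (set V)^d) == fl p) = [forall e in E, ~~ lies_on p e] by case: ifP.
apply/eqP/forall_inP => [flT e eE|h].
  (* the point s + 1 on the axis of e.1.1 is not on the hyperplane *)
  apply/negP => pe; have : fl p (\row_i ((i == e.1.1)%:R * (e.2 + 1)%:R)) by rewrite -flT.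
  move=> /(_ e (conj eE pe)); rewrite /gain_hyperplane /diff_hyperplane /= !mxE eqxx.
  rewrite eq_sym (negPf (loopless e eE)) mul0r mul1r subr0 => /eqP.
  by rewrite eqr_nat addn1 eqn_leq ltnn.
by apply/esym/seteqP; split=> // x _ e [eE pe]; move: (h e eE); rewrite pe.
Qed.
End FiniteField.

(** * Separated placements on a line *)

Section Separated.
Local Open Scope nat_scope.
Context {T : finType}.

Definition separated (d : nat) (f : T -> nat) : Prop :=
  forall i j, i != j -> f i <= f j -> f i + d < f j.

Definition rank_of f (i : T) : nat := #|[set l | f l < f i]|.

(** The blocks [f l, f l + d] are pairwise disjoint. *)
Lemma separated_block d (f : T -> nat) (S : {set T}) lo hi : separated d f -> lo <= hi ->
  (forall l, l \in S -> lo <= f l /\ f l + d < hi) -> lo + #|S| * d.+1 <= hi.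
Proof.
move=> sep lohi hS; rewrite -leq_subRL //.
pose s := [seq f x.1 + x.2 | x : T * 'I_d.+1 <- enum (finset.setX S [set: 'I_d.+1])].
have <- : size s = #|S| * d.+1 by rewrite size_map -cardE cardsX cardsT card_ord.
rewrite -(size_iota lo (hi - lo)); apply: uniq_leq_size => [|y /mapP[[l e]]].
  rewrite map_inj_in_uniq ?enum_uniq // => -[l e] [l' e'] _ _ /= h.
  have [he he'] := (ltn_ord e, ltn_ord e').
  have ll : l = l'.
    apply/eqP/negP => /negP nll; have := sep _ _ nll.
    by rewrite eq_sym in nll; have := sep _ _ nll; lia.
  by rewrite ll in h *; congr (_, _); apply: val_inj => /=; lia.
rewrite mem_enum inE /= => /andP[/hS[h1 h2] _] ->; rewrite mem_iota.
by have := ltn_ord e; lia.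
Qed.

Lemma rank_of_leq (f : T -> nat) i : rank_of f i <= #|T|.-1.
Proof.
rewrite -(cardsC1 i); apply/subset_leq_card/fintype.subsetP => l; rewrite !inE.
by apply: contraTneq => ->; rewrite ltnn.
Qed.

Lemma rank_of_mono (f : T -> nat) i j : f i <= f j -> rank_of f i <= rank_of f j.
Proof.
move=> fij; apply/subset_leq_card/fintype.subsetP => l; rewrite !inE => h.
exact: leq_trans h fij.
Qed.

Lemma rank_of_eq (f g : T -> nat) i :
  (forall l, (f l < f i) = (g l < g i)) -> rank_of f i = rank_of g i.
Proof. by move=> fg; apply: eq_card => l; rewrite !inE. Qed.

Lemma rank_of_block (f : T -> nat) i j : f i <= f j ->
  rank_of f j = rank_of f i + #|[set l | f i <= f l < f j]|.
Proof.
move=> fij; rewrite /rank_of -(cardsID [set l | f l < f i] [set l | f l < f j]).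
by congr (_ + _); apply: eq_card => l; rewrite !inE; lia.
Qed.

Local Notation vals f := (fun l : T => nat_of_ord (f l)).

Lemma spread_bound (d L : nat) (g : {ffun T -> 'I_(L - #|T|.-1 * d)}) i :
  g i + d * rank_of (vals g) i < L.
Proof.
have := ltn_ord (g i); have := rank_of_leq (vals g) i; move: (rank_of _ _) => r hr.
have : d * r <= #|T|.-1 * d by rewrite mulnC leq_mul2r hr orbT.
lia.
Qed.

(** The map g |-> g + d * rank g is a bijection from the injections onto the
    separated functions: it does not change the order of the values, hence not
    the ranks either, so f - d * rank f is its inverse.  The statement also holds
    when the truncated difference is 0, both sides being 0 unless T is empty. *)
Lemma card_separated (d L : nat) :
  #|[set f : {ffun T -> 'I_L} | `[< separated d (vals f) >]]| = (L - #|T|.-1 * d) ^_ #|T|.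
Proof.
set M := L - _; rewrite -[in RHS](card_ord M) -card_inj_ffuns.
pose F (g : {ffun T -> 'I_M}) : {ffun T -> 'I_L} :=
  [ffun i => Ordinal (spread_bound g i)].
have FE g i : F g i = g i + d * rank_of (vals g) i :> nat by rewrite ffunE.
have Flt g i j : (F g i < F g j) = (g i < g j).
  case: (ltnP (g i) (g j)) => gij; rewrite !FE.
    by have := @rank_of_mono (vals g) i j (ltnW gij); nia.
  by have := @rank_of_mono (vals g) j i gij; nia.
have Frank g i : rank_of (vals (F g)) i = rank_of (vals g) i.
  by apply: rank_of_eq => l; rewrite Flt.
have Finj : injective F.
  move=> g g' FF; apply/ffunP => i; apply: val_inj => /=.
  have := FE g i; have := FE g' i; have := Frank g i; have := Frank g' i.
  by rewrite FF => -> -> -> /addIn.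
rewrite -[in RHS](card_imset _ Finj); apply: eq_card => f; rewrite inE.
apply/asboolP/imsetP => [sep|[g + ->]]; last first.
  rewrite inE => /injectiveP ginj i j nij; rewrite leqNgt Flt -leqNgt => gij.
  have {}gij : g i < g j.
    by rewrite ltn_neqAle gij andbT; apply: contraNneq nij => /val_inj/ginj ->.
  rewrite !FE (@rank_of_block (vals g) i j) ?(ltnW gij) //.
  have : 0 < #|[set l | g i <= g l < g j]|.
    by apply/card_gt0P; exists i; rewrite inE leqnn.
  move=> /(leq_pmulr d); rewrite mulnDr /= => hd.
  by rewrite -addnA -addSn leq_add // leq_add2l.
have low i : rank_of (vals f) i * d.+1 <= f i.
  by apply: (@separated_block d (vals f) _ 0) => // l; rewrite inE => li; split=> //;
     apply: sep (ltnW li); apply: contraTneq li => ->; rewrite ltnn.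
have up i : f i + (#|T| - rank_of (vals f) i) * d.+1 <= L + d.
  have -> : #|T| - rank_of (vals f) i = #|[set l | f i <= f l]|.
    rewrite -cardsT -(cardsID [set l | f l < f i] finset.setT) finset.setTI addKn.
    by apply: eq_card => l; rewrite !inE andbT -leqNgt.
  apply: (@separated_block d (vals f) _ _ _ sep) => [|l].
    by have := ltn_ord (f i); lia.
  by rewrite inE => ->; have := ltn_ord (f l); lia.
have gb i : f i - d * rank_of (vals f) i < M.
  have := up i; have := low i; have := rank_of_leq (vals f) i; have := ltn_ord (f i).
  have : 0 < #|T| by apply/card_gt0P; exists i.
  rewrite /M; move: (rank_of _ _) => r; nia.
pose g := [ffun i => Ordinal (gb i)].
have gE i : g i = f i - d * rank_of (vals f) i :> nat by rewrite ffunE.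
have glt i j : f i < f j -> g i < g j.
  move=> fij; rewrite !gE (@rank_of_block (vals f) i j) ?(ltnW fij) //.
  have := low i; set S := [set l | _].
  have : f i + #|S| * d.+1 <= f j.
    apply: (@separated_block d (vals f) _ _ _ sep (ltnW fij)) => l.
    rewrite inE => /andP[-> lj]; split=> //.
    by apply: sep (ltnW lj); apply: contraTneq lj => ->; rewrite ltnn.
  have : 0 < #|S| by apply/card_gt0P; exists i; rewrite inE leqnn.
  nia.
exists g.
  rewrite inE; apply/injectiveP => i j gij; apply/eqP/negP => /negP nij.
  case: (ltngtP (f i) (f j)) => [/glt|/glt|fij]; rewrite ?gij ?ltnn //.
  by have := sep _ _ nij (eq_leq fij); rewrite /= fij ltnNge leq_addr.
apply/ffunP => i; apply: val_inj; rewrite /= FE gE.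
rewrite (@rank_of_eq (vals g) (vals f)) => [|l].
  by rewrite subnK // (leq_trans _ (low i)) // mulnC leq_mul2l leqnSn orbT.
apply/idP/idP => [|/glt//]; apply: contraTT; rewrite -!leqNgt leq_eqVlt.
by case/orP => [/eqP/val_inj il|/glt/ltnW//]; rewrite !gE /rank_of il.
Qed.
End Separated.

Section Windows.
Local Open Scope nat_scope.

(** The points outside D are frozen instead of dropped, so that all the sets of
    placements counted below have the same type. *)
Definition in_window (I : finType) (D : {set I}) (b : I -> nat) (d lo hi : nat)
    (y : I -> nat) : Prop :=
  [/\ forall i, i \notin D -> y i = b i,
      forall i, i \in D -> lo <= y i < hi &
      forall i j, i \in D -> j \in D -> i != j -> y i <= y j -> y i + d < y j].

Lemma card_window (I : finType) (D : {set I}) (b : I -> nat) (d lo hi q : nat) :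
  (forall i, b i <= q) -> hi <= q.+1 ->
  #|[set p : {ffun I -> 'I_q.+1} | `[< in_window D b d lo hi (fun i => p i) >]]| =
    (hi - lo - #|D|.-1 * d) ^_ #|D|.
Proof.
move=> hb hhi; set L := hi - lo.
have <- : #|{: {i | i \in D}}| = #|D| by rewrite card_sig.
rewrite -card_separated.
pose F (f : {ffun {i | i \in D} -> 'I_L}) : {ffun I -> 'I_q.+1} :=
  [ffun i => if insub i is Some t then inord (lo + f t) else inord (b i)].
have fL (f : {ffun {i | i \in D} -> 'I_L}) t : f t < hi - lo by exact: ltn_ord.
have FD f t : F f (val t) = lo + f t :> nat.
  by rewrite ffunE valK inordK //; have := fL f t; lia.
have FN f i : i \notin D -> F f i = b i :> nat.
  by move=> iD; rewrite ffunE insubN // inordK // ltnS.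
have Finj : injective F.
  move=> f g FF; apply/ffunP => t; apply: val_inj => /=.
  by have := FD f t; rewrite FF FD => /addnI.
suff key (p : {ffun I -> 'I_q.+1}) : in_window D b d lo hi (fun i => p i) <->
    exists2 f : {ffun {i | i \in D} -> 'I_L}, separated d (fun t => f t : nat) & p = F f.
  rewrite -[in RHS](card_imset _ Finj); apply: eq_card => p; rewrite inE.
  apply/asboolP/imsetP => [/key[f sep ->]|[f + ->]]; last first.
    by rewrite inE => /asboolP sep; apply/key; exists f.
  by exists f; rewrite // inE; apply/asboolP.
split=> [[pN pD psep]|[f sep ->]].
  have h (t : {i | i \in D}) : p (val t) - lo < L.
    by have /andP[? ?] := pD _ (valP t); rewrite ltn_sub2rE.
  pose g := [ffun t => Ordinal (h t)].
  have gE t : g t = p (val t) - lo :> nat by rewrite ffunE.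
  exists g.
    move=> s t nst; rewrite !gE => hst.
    have := psep _ _ (valP s) (valP t) nst.
    by have := pD _ (valP s); have := pD _ (valP t); move: hst; lia.
  apply/ffunP => i; apply: val_inj => /=.
  have [iD|iD] := boolP (i \in D); last by rewrite FN // pN.
  have -> : i = val (exist _ i iD : {i | i \in D}) by [].
  by rewrite FD gE subnKC //; have /andP[] := pD _ iD.
split=> [i /FN->//|i iD|i j iD jD nij].
  have -> : i = val (exist _ i iD : {i | i \in D}) by [].
  by rewrite FD; have := fL f (exist _ i iD); lia.
have -> : i = val (exist _ i iD : {i | i \in D}) by [].
have -> : j = val (exist _ j jD : {i | i \in D}) by [].
rewrite !FD leq_add2l => h; rewrite -addnA ltn_add2l; exact: sep h.
Qed.

Lemma sub_eq_residue q (u v : 'I_q.+2) s : s < q.+2 ->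
  (u - v == s%:R)%R = (u == v + s :> nat) || (u + q.+2 == v + s).
Proof.
move=> sq; rewrite subr_eq addrC -val_eqE val_addn_residue.
have := ltn_ord u; have := ltn_ord v; move: (nat_of_ord v) => y.
rewrite (_ : val u = u) //; move: (nat_of_ord u) => x yq xq.
case: (ltnP (y + s) q.+2) => h; first by rewrite modn_small //; lia.
by rewrite -(subnK h) modnDr modn_small; lia.
Qed.
End Windows.

(** * Points of the deleted Catalan arrangement modulo q *)

Section Avoiders.
Context {n : nat} (r : 'I_n) (G : {set 'I_n * 'I_n}).

(** Both (i, j, 0) and (j, i, 0) are kept: they encode the same hyperplane. *)
Definition kept_gains : {set 'I_n * 'I_n * 'I_n.+1} :=
  [set e : 'I_n * 'I_n * 'I_n.+1 | (e.1.1 != e.1.2) &&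
     ~~ ((e.1.1 == r) && [exists a : 'I_n, (e.2 == a.+1 :> nat) && ((a, e.1.2) \in G)])].

Definition avoids q (p : 'I_n -> 'I_q.+2) := [forall e in kept_gains, ~~ lies_on p e].

Lemma avoidsP q (p : 'I_n -> 'I_q.+2) : reflect (forall (i j : 'I_n) (s : nat),
   i != j -> (s <= n)%N -> ~ (i = r /\ exists2 a : 'I_n, s = a.+1 & (a, j) \in G) ->
    p i - p j != s%:R) (avoids p).
Proof.
apply: (iffP forall_inP) => [h i j s nij sn nG|h [[i j] s]].
  have := h (i, j, inord s); rewrite /lies_on !inE /= inordK ?ltnS //; apply.
  rewrite nij; apply/negP => /andP[/eqP ir /existsP[a /andP[/eqP sa aG]]].
  by apply: nG; split=> //; exists a.
rewrite inE /= => /andP[nij nG]; apply: h => //; first by rewrite -ltnS.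
case=> /= ir [a /= sa aG]; move/negP: nG; apply; rewrite /= ir eqxx.
apply/existsP; exists a.
by rewrite sa eqxx.
Qed.

(** Translations by constants act freely, and each orbit contains exactly one
    point with p r = 0. *)
Lemma card_avoids_rotation q :
  #|[set p : {ffun 'I_n -> 'I_q.+2} | avoids p]| =
  (q.+2 * #|[set p : {ffun 'I_n -> 'I_q.+2} | avoids p && (p r == 0%R)]|)%N.
Proof.
set A0 := [set p | _ && _].
pose F (x : {ffun 'I_n -> 'I_q.+2} * 'I_q.+2) :=
  [ffun i => x.1 i + x.2] : {ffun 'I_n -> 'I_q.+2}.
have avF f c : avoids (F (f, c)) = avoids f.
  apply: eq_forallb => e; rewrite /lies_on !ffunE /=.
  by rewrite opprD addrACA subrr addr0.
have -> : (q.+2 * #|A0| = #|finset.setX A0 [set: 'I_q.+2]|)%N.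
  by rewrite cardsX cardsT card_ord mulnC.
rewrite -[RHS](@card_in_imset _ _ F) => [|[f a] [g b]].
  apply: eq_card => p; rewrite inE; apply/idP/imsetP => [hp|[[f c]]].
    have E : p = F ([ffun i => p i - p r], p r).
      by apply/ffunP => i; rewrite !ffunE subrK.
    exists ([ffun i => p i - p r], p r) => //.
    by rewrite !inE /= ffunE subrr eqxx -(avF _ (p r)) -E hp.
  by rewrite !inE /= => /andP[/andP[h _] _] ->; rewrite avF.
rewrite !inE /= => /andP[/andP[_ /eqP fr] _] /andP[/andP[_ /eqP gr] _] /ffunP FF.
have ab : a = b by have := FF r; rewrite !ffunE /= fr gr !add0r.
congr (_, _) => //; apply/ffunP => i; have := FF i; rewrite !ffunE /= ab.
exact: addIr.
Qed.
End Avoiders.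

Section Circle.
Local Open Scope nat_scope.
Context {n : nat} {r : 'I_n} {G : {set 'I_n * 'I_n}}.
Context (hG : forall a j : 'I_n, (a, j) \in G -> j != r).
Context {q : nat} (hq : 3 * n < q.+2).
Local Notation point := {ffun 'I_n -> 'I_q.+2}.

(** All the points other than r are more than n away from r, on both sides. *)
Definition spread_window (p : point) : Prop :=
  in_window [set~ r] (fun=> 0) n n.+1 (q.+2 - n) (fun i => p i).

(** For x = (a, j), the point j is a.+1 behind r (a stands for the label a.+1), and
    the others are more than n away from both. *)
Definition close_window (x : 'I_n * 'I_n) (p : point) : Prop :=
  in_window ([set~ r] :\ x.2) (fun i => if i == x.2 then q.+2 - x.1.+1 else 0) n
    n.+1 (q.+2 - x.1.+1 - n) (fun i => p i).

(** On representatives in [0, q[, an equation modulo q splits according to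
    whether adding s wraps around. *)
Lemma avoids_natP (p : point) : avoids r G p <->
  forall (i j : 'I_n) (s : nat), i != j -> s <= n ->
   ~ (i = r /\ exists2 a : 'I_n, s = a.+1 & (a, j) \in G) ->
   p i <> p j + s :> nat /\ p i + q.+2 <> p j + s.
Proof.
split=> [/avoidsP h i j s nij sn nG|h]; last first.
  apply/avoidsP => i j s nij sn nG; rewrite sub_eq_residue; last by lia.
  by have [/eqP/negPf-> /eqP/negPf->] := h i j s nij sn nG.
have := h i j s nij sn nG; rewrite sub_eq_residue; last by lia.
by rewrite negb_or => /andP[/eqP ? /eqP ?].
Qed.

Lemma spread_window_avoids p : spread_window p -> avoids r G p /\ p r = 0 :> nat.
Proof.
move=> [pN pD psep]; have pr : p r = 0 :> nat by apply: pN; rewrite !inE eqxx.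
have D i : i != r -> n < p i < q.+2 - n by move=> ir; apply: pD; rewrite !inE.
split=> //; apply/avoids_natP => i j s nij sn _.
have [ir|ir] := eqVneq i r; last have [jr|jr] := eqVneq j r.
- have jr : j != r by rewrite -ir eq_sym.
  by have := D j jr; rewrite ir pr; lia.
- by have := D i ir; rewrite jr pr; lia.
have := D i ir; have := D j jr.
have := psep j i; rewrite !inE ir jr eq_sym nij => /(_ isT isT isT); lia.
Qed.

Lemma close_window_avoids x p :
  x \in G -> close_window x p -> avoids r G p /\ p r = 0 :> nat.
Proof.
case: x => a j0 aG [/= pN pD psep]; have j0r := hG aG; have an := ltn_ord a.
have pr : p r = 0 :> nat by rewrite pN ?inE ?eqxx ?andbF // eq_sym (negPf j0r).
have pj0 : p j0 = q.+2 - a.+1 :> nat by rewrite pN ?inE eqxx.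
have D i : i != r -> i != j0 -> n < p i < q.+2 - a.+1 - n.
  by move=> ir ij; apply: pD; rewrite !inE ir ij.
split=> //; apply/avoids_natP => i j s nij sn nex.
have [ir|ir] := eqVneq i r.
  have jr : j != r by rewrite -ir eq_sym.
  rewrite ir pr; have [jj|jj] := eqVneq j j0; last by have := D j jr jj; lia.
  rewrite jj pj0; suff : s <> a.+1 by lia.
  by move=> sa; apply: nex; split=> //; exists a; rewrite // jj.
have [jr|jr] := eqVneq j r.
  rewrite jr pr; have [ii|ii] := eqVneq i j0; last by have := D i ir ii; lia.
  by rewrite ii pj0; lia.
have [ii|ii] := eqVneq i j0.
  have jj : j != j0 by rewrite -ii eq_sym.
  by have := D j jr jj; rewrite ii pj0; lia.
have [jj|jj] := eqVneq j j0.
  by have := D i ir ii; rewrite jj pj0; lia.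
have := D i ir ii; have := D j jr jj.
have := psep j i; rewrite !inE ir jr ii jj eq_sym nij => /(_ isT isT isT); lia.
Qed.

Lemma close_window_unique x y p : x \in G -> y \in G ->
  close_window x p -> close_window y p -> x = y.
Proof.
case: x y => a j [b k] aG bG [/= pN pD _] [/= pN' _ _].
have pj : p j = q.+2 - a.+1 :> nat by rewrite pN ?inE eqxx.
have pk : p k = q.+2 - b.+1 :> nat by rewrite pN' ?inE eqxx.
have [an bn] := (ltn_ord a, ltn_ord b).
have jk : k = j.
  apply/eqP; apply/negPn/negP => kj; have := pD k; rewrite !inE kj (hG bG) => /(_ isT).
  by lia.
by rewrite jk in pk *; congr (_, _); apply: val_inj => /=; lia.
Qed.

Lemma close_window_not_spread x p : x \in G -> close_window x p -> ~ spread_window p.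
Proof.
case: x => a j aG [/= pN _ _] [_ pD _].
have pj : p j = q.+2 - a.+1 :> nat by rewrite pN ?inE eqxx.
have := pD j; rewrite !inE (hG aG) => /(_ isT); have := ltn_ord a; lia.
Qed.

(** A point j that is not more than n away from r behind it comes from an arc.  It
    lies beyond q - n, so being more than n away from it forces all the others to
    lie before it. *)
Lemma avoids_window (p : point) : avoids r G p -> p r = 0 :> nat ->
  spread_window p \/ exists2 x, x \in G & close_window x p.
Proof.
move=> /avoids_natP av pr.
have pq i : p i < q.+2 := ltn_ord (p i).
have low j : j != r -> n < p j.
  move=> jr; rewrite ltnNge; apply/negP => h.
  have [|+ _] := av j r (p j) jr h; last by rewrite pr.
  by case=> jr'; rewrite jr' eqxx in jr.
have sep i j : i != r -> j != r -> i != j -> p i <= p j -> p i + n < p j.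
  move=> ir jr nij pij; rewrite ltnNge; apply/negP => h.
  have [|||+ _] := av j i (p j - p i); rewrite ?(eq_sym j) //; try lia.
  by case=> jr'; rewrite jr' eqxx in jr.
have top j : j != r -> q.+2 - n <= p j ->
    exists2 a : 'I_n, p j = q.+2 - a.+1 :> nat & (a, j) \in G.
  move=> jr h; have rj : r != j by rewrite eq_sym.
  have [[a ha aG]|nex] := pselect (exists2 a : 'I_n, q.+2 - p j = a.+1 & (a, j) \in G).
    by exists a => //; have := pq j; lia.
  have [||_ []] := av r j (q.+2 - p j) rj; rewrite ?pr; try lia.
    by case.
  by have := pq j; lia.
have [/existsP[j /andP[jr /(top j jr)[a pj aG]]]|nex] :=
    boolP [exists j, (j != r) && (q.+2 - n <= p j)].
  right; exists (a, j) => //; have an := ltn_ord a.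
  split=> /= [i|i|i k]; rewrite !inE.
  - by rewrite negb_and !negbK => /orP[/eqP ->|/eqP ->];
      rewrite ?eqxx // eq_sym (negPf jr).
  - move=> /andP[ij ir]; have := low i ir.
    have := sep i j ir jr ij; have := sep j i jr ir; rewrite eq_sym ij => /(_ isT).
    by have := pq i; lia.
  - by move=> /andP[_ ir] /andP[_ kr]; exact: sep.
left; split=> [i|i|i k]; rewrite !inE.
- by rewrite negbK => /eqP ->.
- move=> ir; rewrite low // ltnNge; apply: contra nex => h.
  by apply/existsP; exists i; rewrite ir.
- exact: sep.
Qed.

Lemma card_avoids_at_origin :
  #|[set p : point | avoids r G p && (p r == 0%R)]| =
  #|[set p | `[< spread_window p >]]| +
    \sum_(x in G) #|[set p | `[< close_window x p >]]|.
Proof.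
have cardE (P : pred point) : #|[set p | P p]| = \sum_p P p.
  by rewrite -sum1_card big_mkcond; apply: eq_bigr => p _; rewrite inE; case: (P p).
rewrite !cardE; under [X in _ + X]eq_bigr do rewrite cardE.
rewrite exchange_big -big_split; apply: eq_bigr => p _.
rewrite -val_eqE /=.
have [/asboolP h|/asboolP ns] := boolP `[< spread_window p >].
  have [-> ->] := spread_window_avoids h; rewrite big1 // => x xG.
  by case: asboolP => // /(close_window_not_spread xG).
have [/existsP[x /andP[xG /asboolP hx]]|nx] :=
    boolP [exists x in G, `[< close_window x p >]].
  have [-> ->] := close_window_avoids xG hx.
  rewrite (bigD1 x) //=; case: asboolP => // _; rewrite big1 // => y /andP[yG yx].
  by case: asboolP => // hy; rewrite (close_window_unique xG yG hx hy) eqxx in yx.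
rewrite big1 => [|x xG]; last first.
  by case: asboolP => // hx; case/existsP: nx; exists x; rewrite xG; apply/asboolP.
have [/andP[av /eqP pr]|//] := boolP (_ && _).
have [//|[x xG hx]] := avoids_window av pr.
by case/existsP: nx; exists x; rewrite xG; apply/asboolP.
Qed.

Lemma card_spread_window : 1 < n ->
  #|[set p | `[< spread_window p >]]| = (q.+2 - (n ^ 2).+1) ^_ n.-1.
Proof.
move=> n1; rewrite card_window ?leq_subr // cardsC1 card_ord.
by congr (_ ^_ _); rewrite -mulnn; nia.
Qed.

Lemma card_close_window x : 1 < n -> x \in G ->
  #|[set p | `[< close_window x p >]]| = (q.+2 + n - (n ^ 2 + x.1.+2)) ^_ n.-2.
Proof.
move=> n1; case: x => a j /hG jr; rewrite card_window /=; last by lia.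
  have -> : #|[set~ r] :\ j| = n.-2.
    have := cardsD1 j [set~ r]; rewrite cardsC1 card_ord !inE jr; lia.
  (* n = 2 leaves no point to place; there n - 3 would be truncated to 0 and the
     two lengths would differ, but both falling factorials are 1 *)
  have [n2|n2] := eqVneq n 2; first by have -> : n.-2 = 0 by rewrite n2.
  by congr (_ ^_ _); rewrite -mulnn; have := ltn_ord a; nia.
by move=> i; case: ifP => // _; lia.
Qed.
End Circle.

(** * Reading the arrangement and the polynomials *)

Section Arrangement.
Local Open Scope classical_set_scope.

(** The points s e_i and - s e_j of the first hyperplane determine i' and j',
    because s' + 1 is positive.  For the constant 0 the pair (i, j) could be swapped. *)
Lemma diff_hyperplane_inj (R : realType) n (i j i' j' : 'I_n) (s s' : nat) :
  i != j ->
  diff_hyperplane i j s = diff_hyperplane i' j' s'.+1 :> set 'rV[R]_n ->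
  [/\ i = i', j = j' & s = s'.+1].
Proof.
move=> nij HH.
have H (x : 'rV[R]_n) : x ord0 i - x ord0 j = s%:R -> x ord0 i' - x ord0 j' = s'.+1%:R.
  by move=> hx; have : diff_hyperplane i j s x by []; rewrite HH.
have Hi := H (\row_k ((k == i)%:R * s%:R)).
rewrite !mxE eqxx eq_sym (negPf nij) mul1r mul0r subr0 in Hi.
have Hj := H (- \row_k ((k == j)%:R * s%:R)).
rewrite !mxE eqxx (negPf nij) mul1r mul0r oppr0 add0r opprK in Hj.
have pos : (0 : R) < s'.+1%:R by rewrite ltr0n.
have s0 : (0 : R) <= s%:R by rewrite ler0n.
move: {Hi} (Hi erefl) {Hj} (Hj erefl); rewrite !opprK => Hi Hj.
have ii : i' = i.
  apply/eqP; apply: contraT => /negPf ni; move: Hi; rewrite ni mul0r.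
  by case: (j' == i); rewrite ?mul1r ?mul0r; lra.
have jj : j' = j.
  apply/eqP; apply: contraT => /negPf nj; move: Hj; rewrite nj mul0r.
  by case: (i' == j); rewrite ?mul1r ?mul0r; lra.
split=> //; move: Hi; rewrite ii jj eqxx eq_sym (negPf nij) mul1r mul0r subr0.
by move/eqP; rewrite eqr_nat => /eqP.
Qed.

(** Removing the hyperplanes removes no other triple of the Catalan arrangement,
    by [diff_hyperplane_inj]: the removed constants are positive. *)
Lemma catalan_deletion_gain (R : realType) n (r : 'I_n) (G : {set 'I_n * 'I_n}) :
  catalan_deletion R r G = gain_arrangement (kept_gains r G).
Proof.
apply/seteqP; split=> [H [HC HG]|_ [[[i j] s] /= + <-]].
  suff [i [j [s [nij sn HE]]]] : exists i j (s : nat),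
      [/\ i != j, (s <= n)%N & H = diff_hyperplane i j s].
    exists (i, j, inord s); last by rewrite /gain_hyperplane /= inordK ?ltnS.
    rewrite /= inE /= nij; apply/negP => /andP[/eqP ir /existsP[a /andP[/eqP sa aG]]].
    apply: HG; exists a, j; split=> //; rewrite HE ir; congr diff_hyperplane.
    by rewrite -sa inordK.
  case: HC => [[i [j [ij ->]]]|[i [j [s [ij /andP[_ sn] ->]]]]].
    by exists i, j, 0%N; split=> //; rewrite neq_ltn ij.
  by exists i, j, s.
rewrite inE /= => /andP[nij nG]; split.
  case: (posnP s) => [s0|s0]; last first.
    by right; exists i, j, s; split=> //; rewrite s0 -ltnS ltn_ord.
  left; rewrite /gain_hyperplane /= s0.
  case: (ltngtP i j) => [ij|ji|/val_inj ij]; last by rewrite ij eqxx in nij.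
    by exists i, j.
  exists j, i; split=> //; apply/seteqP; split=> x; rewrite /diff_hyperplane /=.
    by move/eqP; rewrite subr_eq0 => /eqP ->; rewrite subrr.
  by move/eqP; rewrite subr_eq0 => /eqP ->; rewrite subrr.
move=> [a [k [aG /diff_hyperplane_inj]]] /= [//|ir jk sa]; move/negP: nG; apply; rewrite ir eqxx; apply/existsP; exists a.
by rewrite sa eqxx jk.
Qed.
End Arrangement.

Lemma poly_eq_large (R : numDomainType) (P Q : {poly R}) (N : nat) :
  (forall k, (N <= k)%N -> P.[k%:R] = Q.[k%:R]) -> P = Q.
Proof.
move=> PQ; apply/eqP; rewrite -subr_eq0; apply/negPn/negP => nz.
pose rs := [seq k%:R : R | k <- iota N (size (P - Q))].
suff: (size rs < size (P - Q)%R)%N by rewrite size_map size_iota ltnn.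
apply: max_poly_roots => //.
  apply/allP => _ /mapP[k + ->]; rewrite mem_iota => /andP[Nk _].
  by rewrite /root hornerD hornerN PQ // subrr.
by rewrite map_inj_uniq ?iota_uniq // => a b /eqP; rewrite eqr_nat => /eqP.
Qed.

Lemma horner_falling_power (R : comNzRingType) (P : {poly R}) k (x : R) :
  (falling_power P k).[x] = falling_power P.[x] k.
Proof.
rewrite /falling_power horner_prod; apply: eq_bigr => i _.
by rewrite hornerD hornerN -polyC_natr hornerC.
Qed.

Lemma falling_power_nat (R : comNzRingType) (x k : nat) :
  falling_power (x%:R : R) k = (x ^_ k)%:R.
Proof.
rewrite /falling_power ffact_prod natr_prod.
have [kx|xk] := leqP k x.
  by apply: eq_bigr => i _; rewrite natrB // ltnW // (leq_trans _ kx).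
rewrite (bigD1 (Ordinal xk)) //= subrr mul0r.
by rewrite [RHS](bigD1 (Ordinal xk)) //= subnn mul0r.
Qed.

Lemma sum_over_digraph n (r : 'I_n) (G : {set 'I_n * 'I_n}) (F : 'I_n -> nat) :
  (forall a j : 'I_n, (a, j) \in G -> j != r) ->
  (\sum_(x in G) F x.1 = \sum_(a < n) outdegree r G a * F a)%N.
Proof.
move=> hG.
rewrite (eq_bigl (fun x : 'I_n * 'I_n => true && ((x.1, x.2) \in G))) => [|[]//].
rewrite -(pair_big_dep xpredT (fun a j => (a, j) \in G) (fun a _ => F a)) /=.
apply: eq_bigr => a _; rewrite sum_nat_const; congr (_ * _)%N.
apply: eq_card => j; rewrite [RHS]inE /= -[LHS]/((a, j) \in G).
by case: (boolP ((a, j) \in G)) => [/hG->|]; rewrite ?andbF.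
Qed.

Theorem theorem4p2 (R : realType) (n : nat) (hn : (2 <= n)%N) (r : 'I_n)
    (G : {set 'I_n * 'I_n})
    (hG : forall a j : 'I_n, (a, j) \in G -> j != r) :
  characteristic_polynomial (catalan_deletion R r G) =
    'X * falling_power ('X - (n ^ 2)%N%:R - 1) (n - 1)%N +
    'X * \sum_(a < n) (outdegree r G a)%:R *
           falling_power ('X - (n ^ 2)%N%:R + n%:R - (a.+1)%:R - 1) (n - 2)%N
    :> {poly int}.
Proof.
(* q = n ^ 2 + 3 n + 2 or more exceeds n * n and 3 n, and makes all the
   subtractions below exact. *)
apply: (@poly_eq_large _ _ _ (n ^ 2 + 3 * n + 2)) => -[|[|q]]; try lia.
move=> hq.
rewrite catalan_deletion_gain finite_field_method; first last.
- by move=> e; rewrite inE => /andP[].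
- by rewrite mulnn; lia.
rewrite -/(avoids _ _ _).
have hq3 : (3 * n < q.+2)%N by lia.
rewrite card_avoids_rotation card_avoids_at_origin //.
rewrite card_spread_window //.
rewrite (eq_bigr _ (fun x xG => card_close_window hG hq3 hn xG)).
rewrite (sum_over_digraph (fun a => (q.+2 + n - (n ^ 2 + a.+2)) ^_ n.-2) hG).
rewrite hornerD !hornerM hornerX horner_falling_power horner_sum natrM natrD mulrDr.
congr (_ * _ + _ * _).
  rewrite !hornerD !hornerN -!polyC_natr !hornerC hornerX.
  rewrite -(falling_power_nat int) subn1; congr falling_power.
  by rewrite natrB; lia.
rewrite natr_sum; apply: eq_bigr => a _.
rewrite hornerM -(polyC_natr _ (outdegree r G a)) hornerC horner_falling_power.
rewrite natrM; congr (_ * _).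
rewrite -(falling_power_nat int) subn2; congr falling_power.
rewrite !hornerD !hornerN -!polyC_natr !hornerC hornerX.
have an := ltn_ord a; rewrite natrB ?natrD; lia.
Qed.
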